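(* Let $G$ be a simple connected graph that is not a path. Then $md(G)\ge 3$ (where $md(G)=\infty$ is allowed).
   Context: For vertices $u,v$ of a connected graph $G$, $d(u,v)$ is the length of a shortest $u$–$v$ path. For $W\subseteq V(G)$ and $v\in V(G)$, $r_m(v|W)$ is the multiset $\{d(v,w): w\in W\}$. $W$ is an m-resolving set if $r_m(u|W)\neq r_m(v|W)$ for all distinct $u,v\in V(G)$. If $G$ has an m-resolving set, $md(G)$ is the minimum cardinality of one; otherwise $md(G)=\infty$. *)

(* Defs.v *)
From mathcomp Require Import all_boot.
From mathcomp Require Import finmap multiset.

Set Implicit Arguments.
Unset Strict Implicit.
Unset Printing Implicit Defensive.

(* A finite graph is a finType V of vertices with an adjacency relation e. *)

Definition simple_graph (V : finType) (e : rel V) : Prop :=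
  symmetric e /\ irreflexive e.

(* The null graph is excluded: a connected graph has at least one vertex. *)
Definition connected_graph (V : finType) (e : rel V) : Prop :=
  0 < #|V| /\ forall u v : V, connect e u v.

Definition graph_iso (V1 V2 : finType) (e1 : rel V1) (e2 : rel V2) : Prop :=
  exists2 f : V1 -> V2, bijective f & {mono f : u v / e1 u v >-> e2 u v}.

Definition path_graph (n : nat) : rel 'I_n :=
  fun i j => (i.+1 == j :> nat) || (j.+1 == i :> nat).

Definition is_path_graph (V : finType) (e : rel V) : Prop :=
  exists n : nat, graph_iso (@path_graph n) e.

(* [path] in MathComp allows repeated vertices, hence the [uniq] condition. *)
Definition upath (V : finType) (e : rel V) (u v : V) (n : nat) : bool :=
  [exists p : n.-tuple V, [&& path e u p, last u p == v & uniq (u :: p)]].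

(* A path without repetition has length < #|V|, so restricting n loses nothing;
   the value is #|V| when there is no path from u to v. *)
Definition dist (V : finType) (e : rel V) (u v : V) : nat :=
  \big[minn/#|V|]_(n < #|V| | upath e u v n) n.

Definition mrepr (V : finType) (e : rel V) (W : {set V}) (v : V) :
    {mset nat}%mset :=
  seq_mset [seq dist e v w | w in W].

Definition m_resolving (V : finType) (e : rel V) (W : {set V}) : bool :=
  [forall u, forall v, (u != v) ==> (mrepr e W u != mrepr e W v)].

(* Extended naturals are encoded in [option nat], None standing for infinity. *)
Definition md (V : finType) (e : rel V) : option nat :=
  if [pick W : {set V} | m_resolving e W] is Some W0
  then Some #|[arg min_(W < W0 | m_resolving e W) #|W|]|
  else None.

Definition leq_inf (k : nat) (d : option nat) : bool :=
  if d is Some n then k <= n else true.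

(* Main.v *)
(** For a two-element set [W = {a, b}], the vertices [a] and [b] have the same
    representation [{0, d(a, b)}], so [W] is not m-resolving, and the empty set
    resolves only the one-vertex graph. If a single vertex [w] is m-resolving,
    then [v |-> d(v, w)] is injective into [{0, ..., |V| - 1}], hence bijective;
    as adjacent vertices have distances differing by one, and every [v <> w] has
    a neighbour one step closer to [w], it is an isomorphism onto a path. *)
Require Import Defs.
From mathcomp Require Import all_boot.
From mathcomp Require Import finmap multiset.
From mathcomp Require Import order.

Set Implicit Arguments.
Unset Strict Implicit.
Unset Printing Implicit Defensive.

Section Distance.

Variables (V : finType) (e : rel V).

Lemma upathP (u v : V) (n : nat) :
  reflect (exists p, [/\ path e u p, last u p = v, uniq (u :: p) & size p = n])
          (upath e u v n).
Proof.
apply: (iffP existsP) => [[p /and3P[pp /eqP lp up]]|[p [pp lp up sp]]].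
  by exists p; rewrite size_tuple.
by exists (tcast sp (in_tuple p)); rewrite val_tcast /= pp lp eqxx.
Qed.

Lemma size_uniq_path (u : V) (p : seq V) : uniq (u :: p) -> size p < #|V|.
Proof. by move=> up; rewrite -[_.+1]/(size (u :: p)) -(card_uniqP up) max_card. Qed.

(** Here [p] may repeat vertices. Shortening it gives a repetition-free path [q], whose length is an
    index below [#|V|] in the minimum and at most [size p], because the vertices of [q] are distinct
    and all occur in [p]. *)
Lemma dist_le (u v : V) (p : seq V) :
  path e u p -> last u p = v -> dist e u v <= size p.
Proof.
move=> pp; case/shortenP: pp => q pq uq sub_q lq.
have ltq := size_uniq_path uq.
apply: (leq_trans _ (uniq_leq_size _ sub_q)); last by case/andP: uq.
rewrite /dist -minEnat -leEnat.
apply: (@Order.TotalTheory.bigmin_inf _ _ _ _ (Ordinal ltq)) => //.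
by apply/upathP; exists q.
Qed.

Lemma dist_path (u v : V) : connect e u v ->
  exists p, [/\ path e u p, last u p = v, uniq (u :: p) & size p = dist e u v].
Proof.
case/connectP=> p pp ->; case/shortenP: pp => q pq uq _.
have uqP : upath e u (last u q) (Ordinal (size_uniq_path uq)).
  by apply/upathP; exists q.
rewrite /dist -minEnat.
have [|i Pi ->] := @Order.TotalTheory.eq_bigmin _ _ _ #|V| _
  (fun n : 'I_#|V| => upath e u (last u q) n) (@nat_of_ord _) uqP.
  (* The default value [#|V|] exceeds every index, so the minimum is attained at an actual path
     length. *)
  by move=> i _; rewrite leEnat ltnW.
exact/upathP.
Qed.

Lemma distxx (u : V) : dist e u u = 0.
Proof. by apply/eqP; rewrite -leqn0 (@dist_le u u [::]). Qed.

Lemma dist_lt_card (u v : V) : connect e u v -> dist e u v < #|V|.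
Proof. by case/dist_path=> p [_ _ /size_uniq_path + <-]. Qed.

Lemma dist_edge (u v w : V) :
  e u v -> connect e v w -> dist e u w <= (dist e v w).+1.
Proof.
by move=> euv /dist_path[p [pp lp _ <-]]; apply: (@dist_le _ _ (v :: p)) => //=;
  rewrite euv.
Qed.

(** The witness is the second vertex of a shortest path: the tail bounds its distance from above,
    [dist_edge] from below. *)
Lemma dist_closer (v w : V) (k : nat) :
  connect e v w -> dist e v w = k.+1 -> exists2 x, e v x & dist e x w = k.
Proof.
move=> cvw dvw; have [[|x p] [pp lp _ sp]] := dist_path cvw.
  by rewrite dvw in sp.
case/andP: pp => evx pp; exists x => //; apply/eqP; rewrite eqn_leq.
have cxw : connect e x w by apply/connectP; exists p.
have [ge_k le_k] := (dist_edge evx cxw, dist_le pp lp).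
by rewrite -[_ <= k]ltnS -[k <= _]ltnS -dvw ge_k -sp ltnS le_k.
Qed.

Lemma dist_sym (u v : V) : symmetric e -> dist e u v = dist e v u.
Proof.
move=> sym_e.
have upath_rev a b n : upath e a b n -> upath e b a n.
  (* The vertex list [a :: p] ends in [last a p], which becomes the new starting point; what remains
     to reverse is [belast a p]. *)
  case/upathP=> p [pp <- up <-]; apply/upathP; exists (rev (belast a p)).
  rewrite size_rev size_belast rev_path (eq_path (e' := e)); last first.
    by move=> x y; rewrite sym_e.
  rewrite -rev_rcons -lastI rev_uniq up; split=> //.
  by case: p {pp up} => //= x p; rewrite rev_cons last_rcons.
by apply: eq_bigl => n; apply/idP/idP; apply: upath_rev.
Qed.

End Distance.

Section Resolving.

Variables (V : finType) (e : rel V).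

Lemma m_resolvingP (W : {set V}) :
  reflect (forall u v, perm_eq [seq dist e u w | w <- enum W]
                               [seq dist e v w | w <- enum W] -> u = v)
          (m_resolving e W).
Proof.
apply: (iffP forallP) => [res u v /eq_seq_msetP euv|res u].
  have /forallP/(_ v)/implyP nuv := res u.
  by apply/eqP; apply: contraTT isT => /nuv; rewrite /mrepr -euv eqxx.
apply/forallP=> v; apply/implyP; apply: contra_neq => /eq_seq_msetP.
exact: res.
Qed.

Lemma m_resolving0 : m_resolving e set0 -> #|V| <= 1.
Proof.
move/m_resolvingP=> res; apply/card_le1_eqP=> u v _ _.
by apply: res; rewrite enum_set0.
Qed.

Lemma m_resolving1 (w : V) :
  m_resolving e [set w] -> injective (fun v => dist e v w).
Proof.
by move/m_resolvingP=> res u v duv; apply: res; rewrite enum_set1 /= duv.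
Qed.

Lemma m_resolving2 (a b : V) :
  symmetric e -> a != b -> ~~ m_resolving e [set a; b].
Proof.
move=> sym_e neq_ab; apply/m_resolvingP => res; apply/(elimN eqP neq_ab)/res.
have eW : perm_eq (enum [set a; b]) [:: a; b].
  apply: uniq_perm; rewrite ?enum_uniq //= ?inE ?andbT //.
  by move=> x; rewrite mem_enum !inE.
apply: perm_trans (perm_map _ eW) _; rewrite perm_sym.
apply: perm_trans (perm_map _ eW) _; rewrite /= !distxx (dist_sym b a sym_e).
(* With [d] the distance between [a] and [b], the lists are now [[:: d; 0]] and [[:: 0; d]]. *)
by rewrite (perm_catC [:: _] [:: _]).
Qed.

Lemma inj_dist_path_graph (w : V) :
  simple_graph e -> connected_graph e ->
  injective (fun v => dist e v w) -> is_path_graph e.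
Proof.
move=> [sym_e irr_e] [_ conn] inj_d.
pose g v := Ordinal (dist_lt_card (conn v w)).
have inj_g : injective g by move=> u v /(congr1 val) /inj_d.
have [f gK fK] : bijective g by apply: inj_card_bij inj_g _; rewrite card_ord.
(* Some neighbour of [v] is one step closer to [w]; by injectivity it can only be [u]. *)
have closer u v : (dist e u w).+1 = dist e v w -> e u v.
  move/esym/(dist_closer (conn v w)) => [x evx /inj_d <-].
  by rewrite sym_e.
have eE u v : e u v = path_graph (g u) (g v).
  apply/idP/orP=> [euv|[]/eqP/closer //]; last by rewrite sym_e.
  have evu : e v u by rewrite sym_e.
  (* The distances of adjacent vertices differ by at most one; equal distances would force [u = v],
     hence a loop. *)
  have := dist_edge euv (conn v w); have := dist_edge evu (conn u w).
  rewrite /= leq_eqVlt ltnS => /orP[/eqP->|le_vu]; first by left.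
  rewrite leq_eqVlt ltnS => /orP[/eqP->|le_uv]; first by right.
  have /inj_d uv : dist e u w = dist e v w by apply/eqP; rewrite eqn_leq le_uv.
  by rewrite uv irr_e in euv.
exists #|V|, f; first by exists g.
by move=> i j; rewrite eE !fK.
Qed.

(** Settles the case of an empty resolving set: with at most one vertex, any distance function is
    injective. *)
Lemma card_le1_path_graph :
  simple_graph e -> connected_graph e -> #|V| <= 1 -> is_path_graph e.
Proof.
move=> simple conn /card_le1_eqP eqV.
have [w _] : exists w, w \in V by apply/card_gt0P; case: conn.
by apply: (@inj_dist_path_graph w) => // u v _; apply: eqV.
Qed.

End Resolving.

Theorem theorem2p7 (V : finType) (e : rel V)
    (e_simple : simple_graph e) (e_connected : connected_graph e)
    (e_not_path : ~ is_path_graph e) :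
  leq_inf 3 (md e).
Proof.
rewrite /md; case: pickP => //= W0 res0.
case: arg_minnP => //= W res _; rewrite leqNgt; apply/negP.
case cW: #|W| => [|[|[|n]]] // _.
- by move: res; rewrite (cards0_eq cW) => /m_resolving0 /card_le1_path_graph; auto.
- have [w eW] := cards1P (introT eqP cW); rewrite eW in res.
  exact/e_not_path/inj_dist_path_graph/m_resolving1/res.
- have [a [b [neq_ab eW]]] := cards2P _ (introT eqP cW).
  have [sym_e _] := e_simple.
  by rewrite eW (negPf (m_resolving2 sym_e neq_ab)) in res.
Qed.
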